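(* The inverted equilibrium $(\Gamma_i,0)=\left(-\frac{\rho}{\|\rho\|},0\right)$ of the Lagrange--Poincaré reduced dynamics of the 3D pendulum on $S^2\times\mathbb{R}^3$ described by $$J\dot\omega=J\omega\times\omega+mg\,\rho\times\Gamma,\qquad \dot\Gamma=\Gamma\times\omega$$ is unstable.
   Context: $\Gamma=R^Te_3\in S^2$ is the gravity direction in the body-fixed frame ($R\in SO(3)$ the attitude of the rigid body, $e_3=(0,0,1)^T$), $\omega\in\mathbb{R}^3$ the body-fixed angular velocity, $J$ the constant symmetric positive definite inertia matrix (body frame, origin at the pivot), $m>0$ the mass, $g>0$ the gravitational acceleration, $\rho\in\mathbb{R}^3$, $\rho\neq0$, the body-fixed vector from the pivot to the center of mass. Unstable means not stable in the sense of Lyapunov. *)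

(* Defs.v *)
From HB Require Import structures.
From mathcomp Require Import all_boot all_order all_algebra.
From mathcomp Require Import all_classical all_reals all_analysis.

Set Implicit Arguments.
Unset Strict Implicit.
Unset Printing Implicit Defensive.

Import Order.TTheory GRing.Theory Num.Theory.
Import numFieldNormedType.Exports.

Local Open Scope classical_set_scope.
Local Open Scope ring_scope.

Section Euclidean3.
Context {R : realType}.
Implicit Types u v : 'cV[R]_3.

Definition dotmul u v : R := \sum_(i < 3) u i 0 * v i 0.

(* The library's norm on 'cV[R]_3 is the sup norm, hence this definition. *)
Definition enorm u : R := Num.sqrt (dotmul u u).

(* Indices are added in 'I_3, i.e. modulo 3. *)
Definition crossmul u v : 'cV[R]_3 :=
  \col_(i < 3) (u (i + 1) 0 * v (i + 2) 0 - u (i + 2) 0 * v (i + 1) 0).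

Definition sphere2 : set 'cV[R]_3 := [set u | enorm u = 1].

Definition sym_posdef (J : 'M[R]_3) : Prop :=
  J^T = J /\ forall u, u != 0 -> 0 < dotmul u (J *m u).

End Euclidean3.

Section Stability.
Context {R : realType} {V : normedModType R}.

(* A dynamical system is represented by the set of its forward trajectories;
   only the values at times t >= 0 are relevant. *)
Implicit Types (traj : set (R -> V)) (xe : V).

Definition is_equilibrium traj xe : Prop := traj (fun=> xe).

(* The notion depends only on the topology of V, so any norm inducing it may be
   used; the norm of a product is the maximum of the norms of the components. *)
Definition lyapunov_stable traj xe : Prop :=
  forall e : R, 0 < e -> exists2 d : R, 0 < d &
    forall x, traj x -> `|x 0 - xe| < d -> forall t : R, 0 <= t -> `|x t - xe| < e.

Definition unstable_equilibrium traj xe : Prop :=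
  is_equilibrium traj xe /\ ~ lyapunov_stable traj xe.

End Stability.

(* Solutions on [0, +oo[ in S^2 x R^3. The equations are imposed for t > 0, where
   the two-sided derivative makes sense; continuity on [0, +oo[ then yields them
   at t = 0 with the right derivative. *)
Definition pendulum_trajectory {R : realType} (J : 'M[R]_3) (m g : R)
    (rho : 'cV[R]_3) : set (R -> 'cV[R]_3 * 'cV[R]_3) :=
  [set x : R -> 'cV[R]_3 * 'cV[R]_3 |
    let Gamma t := (x t).1 in let omega t := (x t).2 in
    [/\ {within `[0, +oo[, continuous x},
        forall t : R, 0 <= t -> sphere2 (Gamma t) &
        forall t : R, 0 < t ->
          [/\ derivable omega t 1, derivable Gamma t 1,
              J *m derive1 omega t = crossmul (J *m omega t) (omega t)
                                 + (m * g) *: crossmul rho (Gamma t) &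
              derive1 Gamma t = crossmul (Gamma t) (omega t)]]].

Definition inverted_equilibrium {R : realType} (rho : 'cV[R]_3) :
    'cV[R]_3 * 'cV[R]_3 :=
  (- ((enorm rho)^-1 *: rho), 0).

(* Main.v *)
(* At the inverted equilibrium Gamma = -u, with u = rho / |rho|, start with
   omega0 small, nonzero and such that u . J omega0 = 0. The momentum Gamma . J omega
   is conserved, hence stays 0, and q = omega . J omega satisfies
   q = q0 + 2 m g (rho . Gamma + |rho|) >= q0 > 0 by conservation of energy. Along the
   motion, F = J omega . (rho x Gamma) satisfies
     F' = (J omega . rho) (omega . Gamma) + m g |rho x Gamma|^2 - q (rho . Gamma).
   While Gamma stays close to -u, the last term is about |rho| q and, as
   J omega . rho = |rho| J omega . (Gamma + u), the first one is at most a small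
   multiple of q. So F' >= |rho| q0 / 2, which is impossible if the motion stays
   bounded for all times.
   The motion exists for all times by Picard iteration, applied to the field
   multiplied by a scalar cutoff: the rescaled flow has the same conserved
   quantities, and these confine it to the region where the cutoff is 1. *)
Require Import Defs.
From mathcomp Require Import all_boot all_order all_algebra.
From mathcomp Require Import all_classical all_reals all_analysis.
From mathcomp Require Import ring lra.

Import Order.TTheory GRing.Theory Num.Theory.
Import numFieldNormedType.Exports.
Local Open Scope ring_scope.
Set Implicit Arguments.
Unset Strict Implicit.

(** * Primitives and differential inequalities *)

Section MinMax.
Context {R : realDomainType}.
Implicit Types c x y : R.

Lemma dist_maxr_le c x y : `|Num.max c x - Num.max c y| <= `|x - y|.
Proof.
have := ler_norm (x - y); have := ler_norm (y - x); rewrite (distrC y) ler_norml.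
by case: (leP c x) => ?; case: (leP c y) => ? ? ?; apply/andP; split; lra.
Qed.

Lemma dist_minr_le c x y : `|Num.min c x - Num.min c y| <= `|x - y|.
Proof.
have := dist_maxr_le (- c) (- x) (- y).
by rewrite -!oppr_min -!opprD !normrN.
Qed.

End MinMax.

Section Antiderivative.
Local Open Scope classical_set_scope.
Local Open Scope ring_scope.
Context {R : realType}.
Implicit Types f phi : R -> R.

(** Both [phi + f] and [phi - f] have nonnegative derivatives inside the interval, hence are
    nondecreasing. Derivatives are taken in the open interval only, as the curves below are
    differentiated at positive times. *)
Lemma dist_le_of_derive f phi (df dphi : R -> R) (a b : R) : a <= b ->
  {within `[a, b], continuous f} ->
  {within `[a, b], continuous phi} ->
  (forall t, t \in `]a, b[ -> is_derive t 1 f (df t)) ->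
  (forall t, t \in `]a, b[ -> is_derive t 1 phi (dphi t)) ->
  (forall t, t \in `]a, b[ -> `|df t| <= dphi t) ->
  `|f b - f a| <= phi b - phi a.
Proof.
move=> ab cf cphi Df Dphi le_df.
have mono (g : R -> R) (dg : R -> R) : {within `[a, b], continuous g} ->
    (forall t, t \in `]a, b[ -> is_derive t 1 g (dg t)) ->
    (forall t, t \in `]a, b[ -> 0 <= dg t) -> g a <= g b.
  move=> cg Dg dg0; apply: (@ger0_derive1_le_cc _ g a b) => //.
  - by move=> t /Dg ?.
  - by move=> t tab; rewrite derive1E; have := Dg _ tab => ?;
      rewrite derive_val; exact: dg0.
  - by rewrite in_itv/= lexx.
  - by rewrite in_itv/= lexx ab.
rewrite ler_norml; apply/andP; split.
- have : (f + phi) a <= (f + phi) b.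
    apply: (mono _ (fun t => df t + dphi t)).
    + by move=> t; apply: continuousD; [exact: cf|exact: cphi].
    + by move=> t tab; have := Df _ tab; have := Dphi _ tab => ? ?; exact: is_deriveD.
    + by move=> t /le_df; rewrite ler_norml => /andP[? _]; lra.
  rewrite !fctE; lra.
- have : (phi - f) a <= (phi - f) b.
    apply: (mono _ (fun t => dphi t - df t)).
    + by move=> t; apply: continuousD; [exact: cphi|apply: continuousN; exact: cf].
    + by move=> t tab; have := Df _ tab; have := Dphi _ tab => ? ?; exact: is_deriveB.
    + by move=> t /le_df; rewrite ler_norml => /andP[? ?]; lra.
  rewrite !fctE; lra.
Qed.

Lemma continuous_lipschitz f (k : R) :
  (forall s t, `|f s - f t| <= k * `|s - t|) -> continuous f.
Proof.
move=> lipf t; apply/cvgrPdist_le => /= e e0.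
have k0 : 0 <= k by have := lipf 1 0; rewrite subr0 normr1 mulr1; apply: le_trans.
near=> s; apply: le_trans (lipf t s) _.
(* [k] may be 0, hence the division by [k + 1]. *)
apply: (@le_trans _ _ ((k + 1) * `|t - s|)).
  by rewrite ler_wpM2r// lerDl.
rewrite mulrC -ler_pdivlMr; last by rewrite ltr_wpDl.
near: s; apply: cvgr_dist_le; first exact: cvg_id.
by rewrite divr_gt0// ltr_wpDl.
Unshelve. all: by end_near. Qed.

(* The integral over [`[0, t]] vanishes for [t <= 0], so that [primitive f]
   is constant there. *)
Definition primitive f (t : R) : R :=
  parameterized_integral (@lebesgue_measure R) 0 t f.

Lemma primitive_le0 f (t : R) : t <= 0 -> primitive f t = 0.
Proof.
rewrite /primitive /parameterized_integral le_eqVlt => /predU1P[->|t0].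
  by rewrite set_itv1 Rintegral_set1.
by rewrite set_itv_ge ?Rintegral_set0// bnd_simp -ltNge.
Qed.

Lemma is_derive_primitive f (t : R) : continuous f -> 0 < t ->
  is_derive t 1 (primitive f) (f t).
Proof.
move=> cf t0.
(* The interval reaches past [t], which makes [t] an interior point for the fundamental theorem of
   calculus. *)
have int : (@lebesgue_measure R).-integrable `[0, (t + 1)] (EFin \o f).
  apply: continuous_compact_integrable; first exact: segment_compact.
  exact: continuous_subspaceT.
have tt1 : t < t + 1 by rewrite ltrDl.
have [D <-] := continuous_FTC1_closed tt1 int t0 (cf t).
by rewrite derive1E; exact: derivableP.
Qed.

Lemma continuous_primitive f : continuous f -> continuous (primitive f).
Proof.
move=> cf t; have [t0|t0|->] := ltgtP t 0.
- apply: (@near_cst_continuous _ _ 0).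
  near=> s; rewrite primitive_le0//; apply: ltW.
  by near: s; exact: lt_nbhsl.
- have D := is_derive_primitive cf t0.
  exact/differentiable_continuous/derivable1_diffP.
- rewrite /continuous_at primitive_le0//.
  apply: (@parameterized_integral_cvg_left _ 0 1) => //.
  apply: continuous_compact_integrable; first exact: segment_compact.
  exact: continuous_subspaceT.
Unshelve. all: by end_near. Qed.

Lemma primitive_lipschitz f (B : R) : continuous f ->
  (forall t, `|f t| <= B) ->
  forall s t, `|primitive f s - primitive f t| <= B * `|s - t|.
Proof.
move=> cf fB.
have B0 : 0 <= B := le_trans (normr_ge0 _) (fB 0).
move=> s t; wlog st : s t / t <= s.
  by case: (leP t s) => [ts|/ltW st] H; [|rewrite distrC (distrC s)]; exact: H.
have [s0|s0] := leP s 0.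
  by rewrite !primitive_le0 ?(le_trans st)// subrr normr0 mulr_ge0.
(* Comparison with [B * x] on the half-line where [f] is integrated; a negative endpoint is
   afterwards replaced by 0, where the primitive has the same value. *)
have key a : 0 <= a -> a <= s ->
    `|primitive f s - primitive f a| <= B * (s - a).
  move=> a0 as_; rewrite mulrBr.
  apply: (@dist_le_of_derive _ (fun x => B * x) f (fun=> B)) => //.
  - exact/continuous_subspaceT/continuous_primitive.
  - by apply: continuous_subspaceT => x; exact: mulrl_continuous.
  - move=> x; rewrite in_itv/= => /andP[ax _].
    by apply: is_derive_primitive => //; exact: le_lt_trans ax.
  - move=> x _; have := is_deriveZ B (is_derive_id x (1 : R)).
    by rewrite /GRing.scale/= mulr1.
rewrite (ger0_norm (_ : 0 <= s - t)) ?subr_ge0//.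
have [t0|t0] := leP 0 t; first exact: key.
rewrite (primitive_le0 _ (ltW t0)) -(primitive_le0 f (lexx 0)).
apply: le_trans (key _ (lexx 0) (ltW s0)) _.
by rewrite ler_wpM2l// lerB// ltW.
Qed.

End Antiderivative.

(** * Global solutions of Lipschitz differential equations *)

Section PicardLindelof.
Local Open Scope classical_set_scope.
Local Open Scope ring_scope.
Context {R : realType} {I : Type}.
Variables (F : (I -> R) -> I -> R) (B K : R) (x0 : I -> R).
Hypothesis K0 : 0 < K.
Hypothesis F_bounded : forall a i, `|F a i| <= B.
(** Lipschitz condition for the sup norm, phrased through bounds [d] because the index type is
    arbitrary. *)
Hypothesis F_lipschitz : forall a b (d : R), (forall i, `|a i - b i| <= d) ->
  forall i, `|F a i - F b i| <= K * d.

(** An index is an argument because [I] may be empty, and then [F_bounded] says nothing about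
    [B]. *)
Let B0 (i : I) : 0 <= B.
Proof. exact: le_trans (F_bounded x0 i). Qed.

Definition picard_step (u : R -> I -> R) (t : R) (i : I) : R :=
  x0 i + primitive (fun s => F (u s) i) t.

Definition picard_iter (n : nat) : R -> I -> R :=
  iter n picard_step (fun=> x0).

(** The class of curves in which the iteration lives: the integrands are continuous on it, and it is
    stable under [picard_step], as [F] is bounded by [B], and under pointwise limits. *)
Definition equilipschitz (u : R -> I -> R) : Prop :=
  forall i (s t : R), `|u s i - u t i| <= B * `|s - t|.

Lemma continuous_field u : equilipschitz u ->
  forall i, continuous (fun s => F (u s) i).
Proof.
move=> lu i; apply: (@continuous_lipschitz _ _ (K * B)) => s t.
by rewrite -mulrA; apply: F_lipschitz => j; exact: lu.
Qed.

Lemma picard_step_lipschitz u : equilipschitz u -> equilipschitz (picard_step u).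
Proof.
move=> lu i s t; rewrite /picard_step opprD addrACA subrr add0r.
by apply: primitive_lipschitz => //; exact: continuous_field.
Qed.

Lemma picard_iter_lipschitz n : equilipschitz (picard_iter n).
Proof.
elim: n => [i s t|n IHn]; last exact: picard_step_lipschitz.
by rewrite subrr normr0 mulr_ge0// (B0 i).
Qed.

Lemma is_derive_picard_step u i (t : R) : equilipschitz u -> 0 < t ->
  is_derive t 1 (fun s => picard_step u s i) (F (u t) i).
Proof.
move=> lu t0.
have D := is_derive_primitive (@continuous_field u lu i) t0.
by have := is_deriveD (is_derive_cst (x0 i) t 1) D; rewrite add0r.
Qed.

(* The exponential weight makes the Picard map a contraction of ratio [1/2]
   on the whole half-line. *)
Let weight (c t : R) : R := c * expR (2 * K * t).

Let is_derive_weight (c : R) (t : R) :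
  is_derive t 1 (weight c) (2 * K * weight c t).
Proof.
have H : is_derive t 1 (fun s : R => 2 * K * s) (2 * K).
  by have := is_deriveZ (2 * K) (is_derive_id t (1 : R)); rewrite /GRing.scale/= mulr1.
have H2 := is_derive1_comp (is_derive_expR (2 * K * t)) H.
have := is_deriveZ c H2; rewrite /GRing.scale/= => H3.
by rewrite [2 * K * _](_ : _ = c * (expR (2 * K * t) * (2 * K)))// /weight; ring.
Qed.

Let continuous_weight (c : R) : continuous (weight c).
Proof.
by move=> t; have D := is_derive_weight c t;
  exact/differentiable_continuous/derivable1_diffP.
Qed.

(** The difference of the two steps vanishes at 0, and its derivative is at most [K * weight c t],
    which is exactly the derivative of [weight (c / 2)]. *)
Lemma picard_step_contracts u v (c : R) : 0 <= c -> equilipschitz u -> equilipschitz v ->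
  (forall (t : R) i, 0 <= t -> `|u t i - v t i| <= weight c t) ->
  forall (t : R) i, 0 <= t -> `|picard_step u t i - picard_step v t i| <= weight (c / 2) t.
Proof.
move=> c0 lu lv uv t i t0.
have lu' := picard_step_lipschitz lu; have lv' := picard_step_lipschitz lv.
pose D s := picard_step u s i - picard_step v s i.
have : `|D t - D 0| <= weight (c / 2) t - weight (c / 2) 0.
  apply: (@dist_le_of_derive _ _ _ (fun s => F (u s) i - F (v s) i)
     (fun s => 2 * K * weight (c / 2) s)) => //.
  - apply: continuous_subspaceT => s; apply: (@continuousB _ _ _ (fun s => picard_step u s i)).
      exact: (continuous_lipschitz (lu' i)).
    exact: (continuous_lipschitz (lv' i)).
  - exact: continuous_subspaceT.
  - move=> s; rewrite in_itv/= => /andP[s0 _].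
    have Du := is_derive_picard_step i lu s0; have Dv := is_derive_picard_step i lv s0.
    exact: is_deriveB.
  - move=> s; rewrite in_itv/= => /andP[/ltW s0 _].
    apply: le_trans (F_lipschitz (fun j => uv s j s0) i) _.
    by rewrite /weight [leRHS](_ : _ = K * (c * expR (2 * K * s)))//; field.
rewrite [D 0](_ : _ = 0) ?subr0 => [H|]; last first.
  by rewrite /D /picard_step !primitive_le0// subrr.
apply: le_trans H _; rewrite lerBlDr lerDl /weight mulr_ge0 ?expR_ge0//.
by rewrite divr_ge0.
Qed.

(** The first step moves by at most [B * t], and [2 * K * t <= expR (2 * K * t)]: hence the initial
    constant [B / (2 * K)], halved by each further step. *)
Let gap (n : nat) : R := B / (2 * K) / 2 ^+ n.

Let gapS n : gap n.+1 = gap n / 2.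
Proof. by rewrite /gap exprSr [(_ * 2)^-1]invfM mulrA. Qed.

Let gap_ge0 (i : I) n : 0 <= gap n.
Proof.
apply: divr_ge0; last exact: exprn_ge0.
by apply: divr_ge0; [exact: B0|rewrite mulr_ge0// ltW].
Qed.

Lemma picard_iter_gap n (t : R) i : 0 <= t ->
  `|picard_iter n.+1 t i - picard_iter n t i| <= weight (gap n) t.
Proof.
elim: n t i => [|n IHn] t i t0; last first.
  rewrite gapS.
  apply: (@picard_step_contracts (picard_iter n.+1) (picard_iter n)) => //.
  - exact: gap_ge0.
  - exact: picard_iter_lipschitz.
  - exact: picard_iter_lipschitz.
have := @picard_iter_lipschitz 1 i t 0.
rewrite [picard_iter 1 0 i](_ : _ = x0 i); last first.
  by rewrite /picard_iter/= /picard_step primitive_le0// addr0.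
rewrite subr0 (ger0_norm t0).
move=> /le_trans; apply.
rewrite /weight /gap expr0 divr1.
have := expR_ge1Dx (2 * K * t) => e1.
apply: (@le_trans _ _ (B / (2 * K) * (2 * K * t))).
  by rewrite mulrA divfK// gt_eqF// mulr_gt0.
by rewrite ler_wpM2l ?divr_ge0 ?(B0 i) ?mulr_ge0 ?(ltW K0)//; lra.
Qed.

Lemma picard_iter_dist m n (t : R) i : 0 <= t ->
  `|picard_iter (n + m) t i - picard_iter n t i| <= weight (2 * gap n) t.
Proof.
move=> t0.
(* The sharper bound is the exact geometric sum of the gaps from [n] to [n + m - 1], which lets the
   induction on [m] close. *)
suff : `|picard_iter (n + m) t i - picard_iter n t i| <=
    weight (2 * gap n - 2 * gap (n + m)%N) t.
  move=> /le_trans; apply; rewrite ler_wpM2r ?expR_ge0//.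
  by rewrite gerBl mulr_ge0// (gap_ge0 i).
elim: m => [|m IHm]; first by rewrite addn0 !subrr normr0 /weight mul0r.
rewrite addnS -(subrKA (picard_iter (n + m) t i)).
apply: le_trans (ler_normD _ _) _.
apply: le_trans (lerD (picard_iter_gap (n + m) i t0) IHm) _.
by rewrite /weight -mulrDl gapS [X in X * _](_ : _ = 2 * gap n - 2 * (gap (n + m) / 2))//; field.
Qed.

Let gap_weight_cvg (t : R) : weight (2 * gap n) t @[n --> \oo] --> 0.
Proof.
rewrite /weight /gap.
have H : (2^-1 : R) ^+ n @[n --> \oo] --> 0.
  by apply: cvg_expr; rewrite ger0_norm; lra.
have : (2 * (B / (2 * K)) * expR (2 * K * t)) * (2^-1 : R) ^+ n @[n --> \oo] -->
    (2 * (B / (2 * K)) * expR (2 * K * t)) * 0 by exact: cvgMr.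
rewrite mulr0; apply: cvg_trans; apply: near_eq_cvg.
by near=> n; rewrite exprVn; ring.
Unshelve. all: by end_near. Qed.

Lemma picard_iter_cvg (t : R) i : 0 <= t -> cvg (picard_iter n t i @[n --> \oo]).
Proof.
move=> t0; apply/cauchy_cvgP/cauchy_exP => e e0.
have /cvgrPdist_lt/(_ e e0)[N _ HN] := gap_weight_cvg t.
exists (picard_iter N t i).
change (\forall n \near \oo, ball (picard_iter N t i) e (picard_iter n t i)).
near=> n.
rewrite -ball_normE/= distrC.
have Nn : (N <= n)%N by near: n; exact: nbhs_infty_ge.
rewrite -(subnKC Nn); apply: le_lt_trans (picard_iter_dist _ _ _ t0) _.
have := HN N (leqnn N); rewrite /= sub0r normrN; apply: le_lt_trans.
exact: ler_norm.
Unshelve. all: by end_near. Qed.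

(* Negative times are sent to [0], where all the iterates are equal to [x0]. *)
Let limit (t : R) (i : I) : R := limn (fun n => picard_iter n (Num.max t 0) i).

Let limit_dist n (t : R) i : 0 <= t ->
  `|limit t i - picard_iter n t i| <= weight (2 * gap n) t.
Proof.
move=> t0; rewrite /limit max_l//.
have c := picard_iter_cvg (i := i) t0.
have cn : `|picard_iter m t i - picard_iter n t i| @[m --> \oo] -->
    `|limn (fun n => picard_iter n t i) - picard_iter n t i|.
  by apply: cvg_norm; apply: cvgB => //; exact: cvg_cst.
rewrite -(cvg_lim _ cn)//; apply: limr_le; first by apply/cvg_ex; eexists; exact: cn.
near=> m.
have nm : (n <= m)%N by near: m; exact: nbhs_infty_ge.
by rewrite -(subnKC nm); exact: picard_iter_dist.
Unshelve. all: by end_near. Qed.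

Let limit_lipschitz : equilipschitz limit.
Proof.
move=> i s t; rewrite /limit.
set s' := Num.max s 0; set t' := Num.max t 0.
have cs : cvg (picard_iter n s' i @[n --> \oo]).
  by apply: picard_iter_cvg; rewrite /s' le_max lexx orbT.
have ct : cvg (picard_iter n t' i @[n --> \oo]).
  by apply: picard_iter_cvg; rewrite /t' le_max lexx orbT.
have cn : `|picard_iter m s' i - picard_iter m t' i| @[m --> \oo] -->
    `|limn (fun n => picard_iter n s' i) - limn (fun n => picard_iter n t' i)|.
  by apply: cvg_norm; apply: cvgB.
rewrite -(cvg_lim _ cn)//; apply: limr_le; first by apply/cvg_ex; eexists; exact: cn.
near=> m.
apply: le_trans (picard_iter_lipschitz m i s' t') _.
rewrite ler_wpM2l ?(B0 i)// /s' /t'.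
by rewrite !(maxC _ 0); exact: dist_maxr_le.
Unshelve. all: by end_near. Qed.

Theorem global_solution_of_lipschitz : exists u : R -> I -> R,
  [/\ u 0 = x0, forall i, continuous (fun t => u t i) &
      forall (t : R) i, 0 < t -> is_derive t 1 (fun s => u s i) (F (u t) i)].
Proof.
(* One more step applied to the limit has the required derivative by construction; what remains is
   that the limit is a fixed point. *)
exists (picard_step limit); split.
- by apply/funext => i; rewrite /picard_step primitive_le0// addr0.
- by move=> i; apply/continuous_lipschitz/picard_step_lipschitz.
- move=> t i t0.
  suff -> : picard_step limit t = limit t by exact: is_derive_picard_step.
  apply/funext => j; apply/eqP; rewrite -subr_eq0 -normr_le0.
  (* Both sides are compared with iterate [n.+1]: the contraction halves the distance [2 * gap n]
     between [limit] and iterate [n], and [limit_dist] gives the other term. *)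
  have c0 : weight (gap n) t + weight (2 * gap n.+1) t @[n --> \oo] --> 0.
    have -> : (fun n => weight (gap n) t + weight (2 * gap n.+1) t) =
        (fun n => weight (2 * gap n) t).
      by apply/funext => n; rewrite /weight gapS; field.
    exact: gap_weight_cvg.
  rewrite -(cvg_lim _ c0)//; apply: limr_ge; first by apply/cvg_ex; eexists; exact: c0.
  near=> n.
  rewrite -(subrKA (picard_iter n.+1 t j)); apply: le_trans (ler_normD _ _) _.
  rewrite [X in _ + X]distrC; apply: lerD; last exact: limit_dist _ _ (ltW t0).
  have -> : gap n = 2 * gap n / 2 by field.
  apply: picard_step_contracts => //; last exact: ltW.
  - by rewrite mulr_ge0// (gap_ge0 j).
  - exact: picard_iter_lipschitz.
  - by move=> s k s0; exact: limit_dist.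
Unshelve. all: by end_near. Qed.

End PicardLindelof.

(** * Cutoff of a locally Lipschitz field *)

Section BoundedLipschitz.
Context {R : realType} {I : finType}.
Implicit Types (G H : (I -> R) -> R) (a b : I -> R).

(** Boundedness is included so that the class is closed under products; it then contains every
    polynomial in clamped coordinates. *)
Definition bounded_lipschitz G : Prop := exists B K : R,
  [/\ 0 <= K, forall a, `|G a| <= B &
      forall a b (d : R), 0 <= d -> (forall i, `|a i - b i| <= d) ->
        `|G a - G b| <= K * d].

Lemma bounded_lipschitz_cst (c : R) : bounded_lipschitz (fun=> c).
Proof.
by exists `|c|, 0; split=> // a b d _ _; rewrite subrr normr0 mul0r.
Qed.

Lemma bounded_lipschitzD G H : bounded_lipschitz G -> bounded_lipschitz H ->
  bounded_lipschitz (fun a => G a + H a).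
Proof.
move=> [B [K [K0 GB GK]]] [C [L [L0 HC HL]]]; exists (B + C), (K + L); split.
- exact: addr_ge0.
- by move=> a; apply: le_trans (ler_normD _ _) _; exact: lerD (GB a) (HC a).
- move=> a b d d0 ab; rewrite mulrDl opprD addrACA.
  by apply: le_trans (ler_normD _ _) _; apply: lerD; [exact: GK|exact: HL].
Qed.

Lemma bounded_lipschitzM G H : bounded_lipschitz G -> bounded_lipschitz H ->
  bounded_lipschitz (fun a => G a * H a).
Proof.
move=> [B [K [K0 GB GK]]] [C [L [L0 HC HL]]].
have B0 : 0 <= B by exact: le_trans (GB (fun=> 0)).
have C0 : 0 <= C by exact: le_trans (HC (fun=> 0)).
exists (B * C), (K * C + B * L); split.
- by rewrite addr_ge0 ?mulr_ge0.
- by move=> a; rewrite normrM ler_pM.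
- move=> a b d d0 ab.
  have -> : G a * H a - G b * H b = (G a - G b) * H a + G b * (H a - H b) by ring.
  apply: le_trans (ler_normD _ _) _; rewrite [leRHS]mulrDl !normrM; apply: lerD.
    by rewrite mulrAC ler_pM ?GK.
  by rewrite -mulrA ler_pM ?HL.
Qed.

Lemma bounded_lipschitzB G H : bounded_lipschitz G -> bounded_lipschitz H ->
  bounded_lipschitz (fun a => G a - H a).
Proof.
move=> bG bH.
have -> : (fun a => G a - H a) = (fun a => G a + (-1) * H a).
  by apply/funext => a; rewrite mulN1r.
exact/bounded_lipschitzD/bounded_lipschitzM/bH/bounded_lipschitz_cst.
Qed.

Lemma bounded_lipschitz_sum (A : Type) (s : seq A) (G : A -> (I -> R) -> R) :
  (forall j, bounded_lipschitz (G j)) ->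
  bounded_lipschitz (fun a => \sum_(j <- s) G j a).
Proof.
move=> bG; elim: s => [|j s IHs].
  under eq_fun do rewrite big_nil; exact: bounded_lipschitz_cst.
by under eq_fun do rewrite big_cons; exact: bounded_lipschitzD.
Qed.

Lemma bounded_lipschitz_prod (A : Type) (s : seq A) (G : A -> (I -> R) -> R) :
  (forall j, bounded_lipschitz (G j)) ->
  bounded_lipschitz (fun a => \prod_(j <- s) G j a).
Proof.
move=> bG; elim: s => [|j s IHs].
  under eq_fun do rewrite big_nil; exact: bounded_lipschitz_cst.
by under eq_fun do rewrite big_cons; exact: bounded_lipschitzM.
Qed.

Definition clamp (r y : R) : R := Num.max (- r) (Num.min r y).

Lemma clamp_id (r y : R) : `|y| <= r -> clamp r y = y.
Proof. by rewrite ler_norml => /andP[? ?]; rewrite /clamp min_r ?max_r. Qed.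

Lemma bounded_lipschitz_clamp (r : R) (i : I) : 0 <= r ->
  bounded_lipschitz (fun a => clamp r (a i)).
Proof.
move=> r0; exists r, 1; split=> //.
  by move=> a; rewrite ler_norml /clamp le_max lexx ge_max ge_min lexx ge0_cp.
move=> a b d d0 /(_ i); rewrite mul1r; apply: le_trans.
exact: le_trans (dist_maxr_le _ _ _) (dist_minr_le _ _ _).
Qed.

Definition cutoff (r y : R) : R := Num.max 0 (Num.min 1 (r + 1 - `|y|)).

Lemma cutoff_eq1 (r y : R) : `|y| <= r -> cutoff r y = 1.
Proof. by move=> yr; rewrite /cutoff min_l ?max_r//; lra. Qed.

Lemma cutoff_eq0 (r y : R) : r + 1 < `|y| -> cutoff r y = 0.
Proof. by move=> yr; rewrite /cutoff max_l// ge_min; apply/orP; right; lra. Qed.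

Lemma bounded_lipschitz_cutoff (r : R) (i : I) :
  bounded_lipschitz (fun a => cutoff r (a i)).
Proof.
exists 1, 1; split=> //.
  move=> a; rewrite ger0_norm /cutoff ?le_max ?lexx//.
  by rewrite ge_max ler01 ge_min lexx.
move=> a b d d0 /(_ i); rewrite mul1r; apply: le_trans.
apply: le_trans (dist_maxr_le _ _ _) _; apply: le_trans (dist_minr_le _ _ _) _.
have -> : r + 1 - `|a i| - (r + 1 - `|b i|) = `|b i| - `|a i| by ring.
by rewrite distrC; exact: ler_dist_dist.
Qed.

(* Rescaling the field by a scalar, rather than truncating the state, only
   changes the speed along orbits: conserved quantities remain conserved. *)
Lemma global_solution_cutoff (f : (I -> R) -> I -> R) (r : R) (x0 : I -> R) :
  0 <= r ->
  (forall i, bounded_lipschitz (fun a => f (fun j => clamp (r + 1) (a j)) i)) ->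
  exists u : R -> I -> R,
  [/\ u 0 = x0, forall i, continuous (fun t => u t i) &
      forall (t : R) i, 0 < t -> is_derive t 1 (fun s => u s i)
        ((\prod_j cutoff r (u t j)) * f (u t) i)].
Proof.
move=> r0 bf.
pose F a i := (\prod_j cutoff r (a j)) * f (fun j => clamp (r + 1) (a j)) i.
(* Clamping makes [F] globally Lipschitz but leaves no trace: wherever it changes a coordinate, that
   coordinate exceeds [r + 1] in absolute value and the cutoff product is 0. *)
have FE a i : F a i = (\prod_j cutoff r (a j)) * f a i.
  have [/forallP ar|] := boolP [forall j, `|a j| <= r + 1].
    rewrite /F; congr (_ * f _ i); apply/funext => j.
    exact: clamp_id.
  rewrite negb_forall => /existsP[j]; rewrite -ltNge => rj.
  by rewrite /F (bigD1 j)//= cutoff_eq0// !mul0r.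
have /choice[B /choice[K BK]] : forall i, exists B K : R,
    [/\ 0 <= K, forall a, `|F a i| <= B &
      forall a b (d : R), 0 <= d -> (forall j, `|a j - b j| <= d) ->
        `|F a i - F b i| <= K * d].
  move=> i; apply: (bounded_lipschitzM _ (bf i)).
  by apply: bounded_lipschitz_prod => j; exact: bounded_lipschitz_cutoff.
have B0 i : 0 <= B i by have [_ /(_ x0) + _] := BK i; exact: le_trans.
have K0 i : 0 <= K i by have [] := BK i.
have le_sum (c : I -> R) i : (forall j, 0 <= c j) -> c i <= \sum_j c j.
  by move=> c0; rewrite (bigD1 i)//= lerDl sumr_ge0.
(* As [I] is finite, sums of the coordinatewise constants serve for all coordinates; the added 1
   makes the Lipschitz constant positive. *)
have [|||u [u0 cu Du]] := @global_solution_of_lipschitz R I F (\sum_i B i)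
    (\sum_i K i + 1) x0.
- by rewrite ltr_wpDl// sumr_ge0.
- move=> a i; have [_ FB _] := BK i.
  by apply: le_trans (FB a) _; exact: le_sum.
- move=> a b d ab i; have [_ _ FK] := BK i.
  have d0 : 0 <= d by apply: le_trans (ab i).
  apply: le_trans (FK a b d d0 ab) _; rewrite ler_wpM2r//.
  by apply: le_trans (le_sum K i K0) _; rewrite lerDl.
by exists u; split=> // t i t0; rewrite -FE; exact: Du.
Qed.

End BoundedLipschitz.

(** * Vector algebra in dimension 3 *)

Section Euclidean3Theory.
Context {R : realType}.
Implicit Types (u v w x y : 'cV[R]_3) (J : 'M[R]_3).

Lemma dotmulE u v : dotmul u v = u 0 0 * v 0 0 + u 1 0 * v 1 0 + u 2 0 * v 2 0.
Proof.
rewrite /dotmul !big_ord_recr big_ord0 /= add0r.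
by congr (u _ _ * v _ _ + u _ _ * v _ _ + u _ _ * v _ _); exact: val_inj.
Qed.

Lemma crossmul0E u v : crossmul u v 0 0 = u 1 0 * v 2 0 - u 2 0 * v 1 0.
Proof. by rewrite mxE !add0r. Qed.

Lemma crossmul1E u v : crossmul u v 1 0 = u 2 0 * v 0 0 - u 0 0 * v 2 0.
Proof.
have e1 : 1 + 1 = 2 :> 'I_3 by exact: val_inj.
have e2 : 1 + 2 = 0 :> 'I_3 by exact: val_inj.
by rewrite mxE e1 e2.
Qed.

Lemma crossmul2E u v : crossmul u v 2 0 = u 0 0 * v 1 0 - u 1 0 * v 0 0.
Proof.
have e1 : 2 + 1 = 0 :> 'I_3 by exact: val_inj.
have e2 : 2 + 2 = 1 :> 'I_3 by exact: val_inj.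
by rewrite mxE e1 e2.
Qed.

(** Expansion into coordinates, after which vector identities are left to [ring]. *)
Definition cross_dotE := (dotmulE, crossmul0E, crossmul1E, crossmul2E).

Lemma dotmulC u v : dotmul u v = dotmul v u.
Proof. by rewrite !dotmulE; ring. Qed.

Lemma dotmulDl u v w : dotmul (u + v) w = dotmul u w + dotmul v w.
Proof. by rewrite !dotmulE !mxE; ring. Qed.

Lemma dotmulDr u v w : dotmul u (v + w) = dotmul u v + dotmul u w.
Proof. by rewrite !dotmulE !mxE; ring. Qed.

Lemma dotmulZl c u v : dotmul (c *: u) v = c * dotmul u v.
Proof. by rewrite !dotmulE !mxE; ring. Qed.

Lemma dotmulZr c u v : dotmul u (c *: v) = c * dotmul u v.
Proof. by rewrite !dotmulE !mxE; ring. Qed.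

Lemma dotmulNr u v : dotmul u (- v) = - dotmul u v.
Proof. by rewrite !dotmulE !mxE; ring. Qed.

Lemma dotmulNl u v : dotmul (- u) v = - dotmul u v.
Proof. by rewrite !dotmulE !mxE; ring. Qed.

Lemma dotmul0r u : dotmul u 0 = 0.
Proof. by rewrite !dotmulE !mxE; ring. Qed.

Lemma dotmul_trmx u v J : dotmul u (J *m v) = dotmul (J^T *m u) v.
Proof.
have dotmulT a b : dotmul a b = (a^T *m b) 0 0.
  by rewrite mxE; apply: eq_bigr => i _; rewrite mxE.
by rewrite !dotmulT mulmxA trmx_mul trmxK.
Qed.

Lemma dotmul_ge0 u : 0 <= dotmul u u.
Proof. by apply: sumr_ge0 => i _; rewrite -expr2 sqr_ge0. Qed.

Lemma dotmul_eq0 u : dotmul u u = 0 -> u = 0.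
Proof.
move=> /psumr_eq0P u0; apply/matrixP => i j; rewrite ord1 mxE.
apply/eqP; rewrite -sqrf_eq0 expr2; apply/eqP/u0 => // k _.
by rewrite -expr2 sqr_ge0.
Qed.

Lemma sqr_coord_le u i : (u i 0) ^+ 2 <= dotmul u u.
Proof.
rewrite /dotmul (bigD1 i)//= -expr2 lerDl sumr_ge0// => j _.
by rewrite -expr2 sqr_ge0.
Qed.

Lemma enorm_gt0 u : u != 0 -> 0 < enorm u.
Proof.
move=> u0; rewrite sqrtr_gt0 lt_neqAle dotmul_ge0 andbT eq_sym.
by apply: contra_neq u0; exact: dotmul_eq0.
Qed.

Lemma sqr_enorm u : enorm u ^+ 2 = dotmul u u.
Proof. by rewrite sqr_sqrtr// dotmul_ge0. Qed.

Lemma coord_le_enorm u i : `|u i 0| <= enorm u.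
Proof.
rewrite -ler_sqr ?nnegrE ?sqrtr_ge0// sqr_enorm real_normK ?num_real//.
exact: sqr_coord_le.
Qed.

Lemma sphere2P u : sphere2 u <-> dotmul u u = 1.
Proof.
rewrite /sphere2/= -sqr_enorm; split => [->|]; first by rewrite expr1n.
by move=> /eqP; rewrite sqrf_eq1 => /orP[/eqP//|/eqP u1];
  have := sqrtr_ge0 (dotmul u u); rewrite -/(enorm u) u1; lra.
Qed.

Lemma norm_dotmul_le u v (c d : R) :
  (forall i, `|u i 0| <= c) -> (forall i, `|v i 0| <= d) ->
  `|dotmul u v| <= 3 * (c * d).
Proof.
move=> uc vd; apply: le_trans (ler_norm_sum _ _ _) _.
apply: (@le_trans _ _ (\sum_(i < 3) c * d)).
  by apply: ler_sum => i _; rewrite normrM ler_pM.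
by rewrite sumr_const card_ord mulr_natl.
Qed.

Lemma norm_crossmul_le u v (c d : R) i :
  (forall i, `|u i 0| <= c) -> (forall i, `|v i 0| <= d) ->
  `|crossmul u v i 0| <= 2 * (c * d).
Proof.
move=> uc vd; rewrite mxE; apply: le_trans (ler_normB _ _) _.
by rewrite mulr_natl mulr2n lerD// normrM ler_pM.
Qed.

Lemma coord_le_mx_norm u i : `|u i 0| <= `|u|.
Proof. by rewrite [leRHS]/Num.Def.normr/= mx_normrE; exact: (le_bigmax _ _ (i, 0)). Qed.

(** A crude upper bound of the operator norm of [J] for the sup norm. *)
Definition entry_sum J : R := \sum_i \sum_j `|J i j|.

Lemma norm_mulmx_le J u (c : R) i :
  (forall i, `|u i 0| <= c) -> `|(J *m u) i 0| <= entry_sum J * c.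
Proof.
move=> uc; rewrite mxE; apply: le_trans (ler_norm_sum _ _ _) _.
have c0 : 0 <= c by apply: le_trans (uc 0).
apply: (@le_trans _ _ ((\sum_j `|J i j|) * c)).
  by rewrite mulr_suml; apply: ler_sum => j _; rewrite normrM ler_wpM2l.
rewrite ler_wpM2r// /entry_sum [leRHS](bigD1 i)//= lerDl.
by apply: sumr_ge0 => k _; apply: sumr_ge0.
Qed.

(** Either the first basis vector is orthogonal to [u], or [u 0 0] is nonzero and [(u_1, - u_0, 0)]
    will do. This provides an initial angular velocity with zero vertical momentum. *)
Lemma exists_orthogonal u : exists2 w, w != 0 & dotmul w u = 0.
Proof.
have [u0|u0] := eqVneq (u 0 0) 0.
  exists (delta_mx 0 0); last by rewrite dotmulE !mxE/= u0; ring.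
  by apply/eqP => /matrixP/(_ 0 0); rewrite !mxE/= => /eqP; rewrite oner_eq0.
exists (\col_i (if i == 1 then - u 0 0 else if i == 0 then u 1 0 else 0)).
  by apply: contra_neq u0 => /matrixP/(_ 1 0); rewrite !mxE/= => /eqP;
    rewrite oppr_eq0 => /eqP.
by rewrite dotmulE !mxE/=; ring.
Qed.

(** * The quadratic form of a positive definite matrix *)

Section PositiveDefinite.
Variable J : 'M[R]_3.
Hypothesis hJ : sym_posdef J.

Lemma posdef_ge0 u : 0 <= dotmul u (J *m u).
Proof.
have [->|u0] := eqVneq u 0; first by rewrite mulmx0 dotmul0r.
exact/ltW/hJ.2.
Qed.

Lemma posdef_dotmulC u v : dotmul u (J *m v) = dotmul v (J *m u).
Proof. by rewrite dotmul_trmx hJ.1 dotmulC. Qed.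

(** For [v] nonzero, the form at [c *: u - b *: v], with [b = u . J v] and [c = v . J v], equals
    [c * (a * c - b ^+ 2)], where [a = u . J u]. *)
Lemma posdef_cauchy_schwarz u v :
  dotmul u (J *m v) ^+ 2 <= dotmul u (J *m u) * dotmul v (J *m v).
Proof.
have [->|v0] := eqVneq v 0.
  by rewrite mulmx0 !dotmul0r mulr0 expr0n.
set b := dotmul u (J *m v); set a := dotmul u (J *m u).
set c := dotmul v (J *m v); have c0 : 0 < c by exact: hJ.2.
have := posdef_ge0 (c *: u - b *: v).
rewrite mulmxDr mulmxN -!scalemxAr !(dotmulDl, dotmulDr, dotmulNl, dotmulNr).
rewrite !(dotmulZl, dotmulZr) (posdef_dotmulC v u) -/a -/b -/c.
rewrite [X in 0 <= X -> _](_ : _ = c * (a * c - b ^+ 2)); last by ring.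
by rewrite pmulr_rge0// subr_ge0.
Qed.

Lemma posdef_unitmx : J \in unitmx.
Proof.
rewrite unitmxE unitfE; apply/negP => /det0P[v v0 vJ].
have := hJ.2 v^T; rewrite dotmul_trmx hJ.1.
rewrite -[J *m v^T]trmxK trmx_mul trmxK hJ.1 vJ trmx0.
rewrite dotmulC dotmul0r ltxx => /(_ _)/notF; apply.
by apply: contra_neq v0 => /(congr1 trmx); rewrite trmxK trmx0.
Qed.

(** The coordinate [u i 0] is [u . J p_i] with [p_i = J^-1 e_i], so the Cauchy-Schwarz inequality
    bounds its square by [(p_i . J p_i) (u . J u)]. No eigenvalue is involved. *)
Lemma posdef_coercive : exists2 K : R, 0 < K &
  forall u i, (u i 0) ^+ 2 <= K * dotmul u (J *m u).
Proof.
pose p (i : 'I_3) : 'cV[R]_3 := invmx J *m delta_mx i 0.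
exists (1 + \sum_i dotmul (p i) (J *m p i)).
  by rewrite ltr_wpDr// sumr_ge0// => i _; exact: posdef_ge0.
move=> u i.
have -> : u i 0 = dotmul u (J *m p i).
  rewrite /p mulKVmx ?posdef_unitmx// /dotmul (bigD1 i)//= !mxE eqxx mulr1.
  by rewrite big1 ?addr0// => j ji; rewrite mxE (negbTE ji) mulr0.
apply: le_trans (posdef_cauchy_schwarz _ _) _.
rewrite mulrC ler_wpM2r ?posdef_ge0// (bigD1 i)//=.
rewrite addrCA lerDl addr_ge0// sumr_ge0// => j _; exact: posdef_ge0.
Qed.

End PositiveDefinite.

(** By Lagrange's identity, [|u|^2 |v|^2 - (u . v)^2] is the squared length of the cross product. *)
Lemma norm_dotmul_le_enorm u v : dotmul v v = 1 -> `|dotmul u v| <= enorm u.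
Proof.
move=> v1; rewrite -ler_sqr ?nnegrE ?sqrtr_ge0// sqr_enorm real_normK ?num_real//.
rewrite -[leRHS]mulr1 -v1 -subr_ge0.
have -> : dotmul u u * dotmul v v - dotmul u v ^+ 2 =
    dotmul (crossmul u v) (crossmul u v) by rewrite !cross_dotE; ring.
exact: dotmul_ge0.
Qed.

End Euclidean3Theory.

(** * Motions of the pendulum *)

Section VectorDerivative.
Context {R : realType}.
Implicit Types (a b : R -> 'cV[R]_3) (t : R).

(** Working by coordinates gives direct access to the scalar rules of differentiation;
    [coord_derive_derivable] returns to vector derivatives. *)
Definition coord_derive a t (da : 'cV[R]_3) : Prop :=
  forall i, is_derive t 1 (fun s => a s i 0) (da i 0).

Definition coord_continuous_fun a : Prop := forall i, continuous (fun t => a t i 0).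

Lemma coord_continuousP a : coord_continuous_fun a -> continuous a.
Proof.
move=> ca t; apply/cvgrPdist_le => /= e e0; near=> s.
rewrite /Num.Def.normr/= mx_normrE (bigmax_le _ (ltW e0))//= => -[i j] _.
rewrite !mxE/= ord1; move: i {j}; near: s; apply: filter_forall => i.
by have /cvgrPdist_le/(_ _ e0) := ca i t.
Unshelve. all: by end_near. Qed.

Lemma coord_derive_derivable a t da : coord_derive a t da ->
  derivable a t 1 /\ derive1 a t = da.
Proof.
move=> Da; have D : derivable a t 1.
  by apply/derivable_mxP => i j; rewrite (ord1 j); have := Da i => ?.
split=> //; rewrite derive1E derive_mx//; apply/matrixP => i j.
by rewrite mxE (ord1 j); have := Da i => ?; exact: derive_val.
Qed.

Lemma is_derive_mul (f g : R -> R) t (df dg : R) :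
  is_derive t 1 f df -> is_derive t 1 g dg ->
  is_derive t 1 (fun s => f s * g s) (df * g t + f t * dg).
Proof.
move=> Df Dg; have := is_deriveM Df Dg; rewrite /GRing.scale/=.
by rewrite [X in is_derive _ _ _ X](_ : _ = df * g t + f t * dg)//; ring.
Qed.

Lemma is_derive_dotmul a b t da db : coord_derive a t da -> coord_derive b t db ->
  is_derive t 1 (fun s => dotmul (a s) (b s)) (dotmul da (b t) + dotmul (a t) db).
Proof.
move=> Da Db; rewrite /dotmul -big_split/=.
have := is_derive_sum (fun i => is_derive_mul (Da i) (Db i)).
by congr (is_derive _ _ _ _); apply/funext => s; rewrite fct_sumE.
Qed.

Lemma coord_derive_cst u t : coord_derive (fun=> u) t 0.
Proof. by move=> i; rewrite mxE; exact: is_derive_cst. Qed.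

Lemma coord_derive_mulmx (A : 'M[R]_3) a t da : coord_derive a t da ->
  coord_derive (fun s => A *m a s) t (A *m da).
Proof.
move=> Da i; rewrite mxE.
have := is_derive_sum (fun j => is_deriveZ (A i j) (Da j)).
by congr (is_derive _ _ _ _); apply/funext => s; rewrite mxE fct_sumE.
Qed.

Lemma coord_derive_crossmul u a t da : coord_derive a t da ->
  coord_derive (fun s => crossmul u (a s)) t (crossmul u da).
Proof.
move=> Da i; rewrite mxE.
have := is_deriveB (is_deriveZ (u (i + 1) 0) (Da (i + 2)))
  (is_deriveZ (u (i + 2) 0) (Da (i + 1))).
by congr (is_derive _ _ _ _); apply/funext => s; rewrite mxE.
Qed.

Lemma continuous_dotmul a b : coord_continuous_fun a -> coord_continuous_fun b ->
  continuous (fun t => dotmul (a t) (b t)).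
Proof.
move=> ca cb; under eq_fun do rewrite dotmulE.
move=> t; have cM i := continuousM (ca i t) (cb i t).
exact: (continuousD (continuousD (cM 0) (cM 1)) (cM 2)).
Qed.

Lemma coord_continuous_cst u : coord_continuous_fun (fun=> u).
Proof. by move=> i t; exact: cvg_cst. Qed.

Lemma coord_continuous_mulmx (A : 'M[R]_3) a : coord_continuous_fun a ->
  coord_continuous_fun (fun s => A *m a s).
Proof.
move=> ca i.
have -> : (fun s => (A *m a s) i 0) = (fun s => dotmul (row i A)^T (a s)).
  by apply/funext => s; rewrite mxE; apply: eq_bigr => j _; rewrite !mxE.
exact/continuous_dotmul/ca/coord_continuous_cst.
Qed.

Lemma coord_continuous_crossmul u a : coord_continuous_fun a ->
  coord_continuous_fun (fun s => crossmul u (a s)).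
Proof.
move=> ca i; under eq_fun do rewrite mxE.
move=> t; have cM l n : {for t, continuous (fun s => u l 0 * a s n 0)}.
  by apply: (@continuousM _ _ (fun=> u l 0)); [exact: cvg_cst|exact: ca].
exact: (continuousB (cM (i + 1) (i + 2)) (cM (i + 2) (i + 1))).
Qed.

(** The derivative is known at positive times only; continuity carries the constancy down to time
    0. *)
Lemma derive0_eq (f : R -> R) t : continuous f ->
  (forall s : R, 0 < s -> is_derive s 1 f 0) -> 0 <= t -> f t = f 0.
Proof.
move=> cf Df t0; apply/eqP; rewrite -subr_eq0 -normr_le0.
rewrite -[leRHS](subrr 0).
apply: (@dist_le_of_derive _ f (fun=> 0) (fun=> 0) (fun=> 0)) => //.
- exact: continuous_subspaceT.
- by apply: continuous_subspaceT => s; exact: cvg_cst.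
- by move=> s; rewrite in_itv/= => /andP[s0 _]; exact: Df.
- by move=> s _; rewrite normr0.
Qed.

End VectorDerivative.

Section Motion.
Context {R : realType}.
Variables (J : 'M[R]_3) (k : R) (rho : 'cV[R]_3).
Hypothesis hJ : sym_posdef J.
Implicit Types (Gamma omega : R -> 'cV[R]_3) (c : R -> R).

(* A motion of the pendulum run at the speed [c t]; [k] stands for [m * g]. *)
Definition motion c Gamma omega : Prop :=
  [/\ coord_continuous_fun Gamma, coord_continuous_fun omega &
      forall t : R, 0 < t ->
        coord_derive Gamma t (c t *: crossmul (Gamma t) (omega t)) /\
        exists2 domega, coord_derive omega t domega &
          J *m domega = c t *: (crossmul (J *m omega t) (omega t) +
                                k *: crossmul rho (Gamma t))].

(** * Conserved quantities, whatever the speed [c] *)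

Section Conserved.
Variables (c : R -> R) (Gamma omega : R -> 'cV[R]_3) (t : R).
Hypotheses (mot : motion c Gamma omega) (t0 : 0 <= t).

(** The velocity of [Gamma] is a multiple of [Gamma x omega], orthogonal to [Gamma]. *)
Lemma motion_dotmul_Gamma :
  dotmul (Gamma t) (Gamma t) = dotmul (Gamma 0) (Gamma 0).
Proof.
have [cG cw D] := mot.
apply: (@derive0_eq _ (fun s => dotmul (Gamma s) (Gamma s))) => //.
  exact: continuous_dotmul.
move=> s s0; have [DG _] := D _ s0.
have := is_derive_dotmul DG DG; congr (is_derive _ _ _ _).
by rewrite dotmulZl dotmulZr !cross_dotE; ring.
Qed.

(** The triple products [(Gamma x omega) . J omega] and [Gamma . (J omega x omega)] cancel, and the
    torque [rho x Gamma] is orthogonal to [Gamma]. *)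
Lemma motion_vertical_momentum :
  dotmul (Gamma t) (J *m omega t) = dotmul (Gamma 0) (J *m omega 0).
Proof.
have [cG cw D] := mot.
apply: (@derive0_eq _ (fun s => dotmul (Gamma s) (J *m omega s))) => //.
  exact/continuous_dotmul/coord_continuous_mulmx.
move=> s s0; have [DG [dw Dw Jdw]] := D _ s0.
have := is_derive_dotmul DG (coord_derive_mulmx J Dw); congr (is_derive _ _ _ _).
rewrite Jdw dotmulZl !dotmulZr dotmulDr dotmulZr.
by rewrite !cross_dotE; ring.
Qed.

(** This is twice the total energy. By symmetry of [J] the kinetic part varies at the rate
    [2 c k omega . (rho x Gamma)], which is also that of [2 k rho . Gamma]. *)
Lemma motion_energy :
  dotmul (omega t) (J *m omega t) - 2 * k * dotmul rho (Gamma t) =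
  dotmul (omega 0) (J *m omega 0) - 2 * k * dotmul rho (Gamma 0).
Proof.
have [cG cw D] := mot.
apply: (@derive0_eq _ (fun s => dotmul (omega s) (J *m omega s) -
    2 * k * dotmul rho (Gamma s))) => //.
  have cE := @continuous_dotmul _ _ _ cw (coord_continuous_mulmx (A := J) cw).
  have cP := @continuous_dotmul _ _ _ (coord_continuous_cst (u := rho)) cG.
  move=> s.
  exact: (continuousB (cE s) (continuousM (@cst_continuous _ _ (2 * k) s) (cP s))).
move=> s s0; have [DG [dw Dw Jdw]] := D _ s0.
have D1 := is_derive_dotmul Dw (coord_derive_mulmx J Dw).
have D2 := is_deriveZ (2 * k) (is_derive_dotmul (coord_derive_cst rho s) DG).
have := is_deriveB D1 D2; congr (is_derive _ _ _ _).
rewrite (posdef_dotmulC hJ dw) Jdw /GRing.scale/= !dotmulZr dotmulDr dotmulZr.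
by rewrite [dotmul 0 _]dotmulC dotmul0r !cross_dotE; ring.
Qed.

End Conserved.


Lemma motion_existence (Gamma0 omega0 : 'cV[R]_3) : 0 <= k ->
  dotmul Gamma0 Gamma0 = 1 ->
  exists Gamma omega, [/\ motion (fun=> 1) Gamma omega, Gamma 0 = Gamma0 &
    omega 0 = omega0].
Proof.
move=> k0 G01.
pose gam (a : 'I_3 + 'I_3 -> R) : 'cV[R]_3 := \col_i a (inl i).
pose om (a : 'I_3 + 'I_3 -> R) : 'cV[R]_3 := \col_i a (inr i).
pose torque (a : 'I_3 + 'I_3 -> R) : 'cV[R]_3 :=
  crossmul (J *m om a) (om a) + k *: crossmul rho (gam a).
pose f (a : 'I_3 + 'I_3 -> R) (j : 'I_3 + 'I_3) : R := match j with
  | inl i => crossmul (gam a) (om a) i 0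
  | inr i => (invmx J *m torque a) i 0
  end.
have [K K0 HK] := posdef_coercive hJ.
pose q0 := dotmul omega0 (J *m omega0).
(* A bound for the squares of the coordinates of [omega]: by energy conservation [omega . J omega]
   grows by at most [4 * k * enorm rho], as [rho . Gamma] stays within [enorm rho] of 0. *)
pose M := K * (q0 + 4 * k * enorm rho).
have M0 : 0 <= M.
  by rewrite mulr_ge0 ?(ltW K0)// addr_ge0 ?posdef_ge0// !mulr_ge0// sqrtr_ge0.
(* Dominates both the coordinates of [Gamma], at most 1, and those of [omega], since [y ^+ 2 <= M]
   implies [|y| <= 1 + M]. *)
pose r := 1 + M; have r0 : 0 <= r by rewrite addr_ge0.
pose x0 (j : 'I_3 + 'I_3) : R :=
  match j with inl i => Gamma0 i 0 | inr i => omega0 i 0 end.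
(* The field is polynomial in the six coordinates, so the closure properties apply to its clamped
   version. *)
have f_bl j : bounded_lipschitz (fun a => f (fun l => clamp (r + 1) (a l)) j).
  have bl_clamp l : bounded_lipschitz
      (fun a : 'I_3 + 'I_3 -> R => clamp (r + 1) (a l)).
    by apply: bounded_lipschitz_clamp; rewrite addr_ge0.
  pose vbl (G : ('I_3 + 'I_3 -> R) -> 'cV[R]_3) :=
    forall i, bounded_lipschitz (fun a => G a i 0).
  have vbl_cst u : vbl (fun=> u) by move=> i; exact: bounded_lipschitz_cst.
  have vbl_gam : vbl (fun a => gam (fun l => clamp (r + 1) (a l))).
    by move=> i; under eq_fun do rewrite mxE.
  have vbl_om : vbl (fun a => om (fun l => clamp (r + 1) (a l))).
    by move=> i; under eq_fun do rewrite mxE.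
  have vbl_mulmx (A : 'M[R]_3) G : vbl G -> vbl (fun a => A *m G a).
    move=> bG i; under eq_fun do rewrite mxE.
    apply: bounded_lipschitz_sum => l.
    by apply: bounded_lipschitzM => //; exact: bounded_lipschitz_cst.
  have vbl_cross G H : vbl G -> vbl H -> vbl (fun a => crossmul (G a) (H a)).
    move=> bG bH i; under eq_fun do rewrite mxE.
    by apply: bounded_lipschitzB; exact: bounded_lipschitzM.
  case: j => i; rewrite /f; first exact: vbl_cross.
  apply: (vbl_mulmx) => l; rewrite /torque; under eq_fun do rewrite mxE.
  apply: bounded_lipschitzD; first by apply: vbl_cross => //; exact: vbl_mulmx.
  under eq_fun do rewrite mxE.
  apply: bounded_lipschitzM; first exact: bounded_lipschitz_cst.
  exact: vbl_cross.
have [u [u0 cu Du]] := global_solution_cutoff x0 r0 f_bl.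
pose c t := \prod_j cutoff r (u t j).
pose Gamma t := gam (u t); pose omega t := om (u t).
have G0 : Gamma 0 = Gamma0 by apply/matrixP => i j; rewrite !mxE u0/= (ord1 j).
have w0 : omega 0 = omega0 by apply/matrixP => i j; rewrite !mxE u0/= (ord1 j).
have mot : motion c Gamma omega.
  split.
  - by move=> i; under eq_fun do rewrite mxE; exact: cu.
  - by move=> i; under eq_fun do rewrite mxE; exact: cu.
  - move=> t t0; split.
      move=> i; rewrite mxE; under eq_fun do rewrite mxE.
      exact: (Du t (inl i) t0).
    exists (c t *: (invmx J *m torque (u t))).
      move=> i; rewrite mxE; under eq_fun do rewrite mxE.
      exact: (Du t (inr i) t0).
    by rewrite -scalemxAr mulKVmx ?posdef_unitmx.
have G1 t : 0 <= t -> dotmul (Gamma t) (Gamma t) = 1.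
  by move=> t0; rewrite (motion_dotmul_Gamma mot t0) G0.
have sqr_le1 (y b : R) : 0 <= b -> y ^+ 2 <= b -> `|y| <= 1 + b.
  move=> b0 yb; rewrite -ler_sqr ?nnegrE ?addr_ge0// real_normK ?num_real//.
  by apply: le_trans yb _; rewrite sqrrD expr1n mul1r; have := sqr_ge0 b; lra.
(* The conservation laws of the rescaled motion keep every coordinate within [r], so each cutoff
   factor is 1 and the motion has unit speed. *)
have c1 t : 0 <= t -> c t = 1.
  move=> t0; apply: big1 => -[i|i] _; apply: cutoff_eq1.
    have -> : u t (inl i) = Gamma t i 0 by rewrite mxE.
    have : (Gamma t i 0) ^+ 2 <= 1 by rewrite -(G1 _ t0) sqr_coord_le.
    rewrite -[leRHS](expr1n _ 2) -real_normK ?num_real// ler_sqr ?nnegrE//.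
    by move=> /le_trans; apply; rewrite /r lerDl.
  have -> : u t (inr i) = omega t i 0 by rewrite mxE.
  apply: sqr_le1 => //; apply: le_trans (HK _ _) _; rewrite ler_wpM2l ?(ltW K0)//.
  have := motion_energy mot t0; rewrite w0 G0 -/q0.
  have := norm_dotmul_le_enorm rho (G1 _ t0); rewrite ler_norml => /andP[_ h1].
  have := norm_dotmul_le_enorm rho G01; rewrite ler_norml => /andP[h2 _].
  move: (ler_wpM2l k0 h1) (ler_wpM2l k0 h2); lra.
exists Gamma, omega; split=> //; have [cG cw D] := mot; split=> // t t0.
by have := D t t0; rewrite c1// ltW.
Qed.

End Motion.

(** The constraint to the sphere comes from conservation of the length of [Gamma]; the rest passes
    from coordinates to vectors. *)
Lemma motion_trajectory (R : realType) (J : 'M[R]_3) (m g : R) (rho : 'cV[R]_3)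
    (Gamma omega : R -> 'cV[R]_3) :
  motion J (m * g) rho (fun=> 1) Gamma omega -> dotmul (Gamma 0) (Gamma 0) = 1 ->
  pendulum_trajectory J m g rho (fun t => (Gamma t, omega t)).
Proof.
move=> mot G01; have [cG cw D] := mot; split.
- apply: continuous_subspaceT => t.
  exact: (cvg_pair (@coord_continuousP _ _ cG t) (@coord_continuousP _ _ cw t)).
- move=> t t0; apply/sphere2P; rewrite (motion_dotmul_Gamma mot t0); exact: G01.
- move=> t t0; have [DG [dw Dw Jdw]] := D t t0.
  have [dG GE] := coord_derive_derivable DG.
  have [dw' wE] := coord_derive_derivable Dw.
  split; [exact: dw'|exact: dG| |].
    by rewrite wE Jdw scale1r.
  by rewrite GE scale1r.
Qed.

(** The torque vanishes because [Gamma] is parallel to [rho], and all other terms contain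
    [omega = 0]. *)
Lemma inverted_equilibriumP (R : realType) (J : 'M[R]_3) (m g : R)
    (rho : 'cV[R]_3) : rho != 0 ->
  is_equilibrium (pendulum_trajectory J m g rho) (inverted_equilibrium rho).
Proof.
move=> rho0; have N0 := enorm_gt0 rho0.
apply: (@motion_trajectory _ J m g rho
  (fun=> - ((enorm rho)^-1 *: rho)) (fun=> 0)); last first.
  rewrite dotmulNl dotmulNr opprK dotmulZl dotmulZr -sqr_enorm.
  by field; rewrite gt_eqF.
split; [exact: coord_continuous_cst|exact: coord_continuous_cst|].
move=> t t0; split.
  rewrite [X in coord_derive _ _ X](_ : _ = 0); first exact: coord_derive_cst.
  by apply/matrixP => i j; rewrite !mxE; ring.
exists 0; first exact: coord_derive_cst.
by rewrite !mulmx0; apply/matrixP => i j; rewrite !mxE; ring.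
Qed.

(** * Instability *)

(** With [L = J w], the left-hand side is the derivative of [L . (rho x v)] along a motion of unit
    speed. When the products are expanded, the two terms [(L . v) (w . rho)] cancel. *)
Lemma virial_derivative (R : realType) (k : R) (rho L v w : 'cV[R]_3) :
  dotmul (crossmul L w + k *: crossmul rho v) (crossmul rho v) +
    dotmul L (crossmul rho (crossmul v w)) =
  dotmul L rho * dotmul w v + k * dotmul (crossmul rho v) (crossmul rho v) -
    dotmul w L * dotmul rho v.
Proof. by rewrite dotmulDl dotmulZl !cross_dotE; ring. Qed.

(** Writing [q] for [w . J w], [N] for [enorm rho] and [A] for [entry_sum J], the three terms of
    [virial_derivative] are at least [- 9 A K e N q], 0 and [N q (1 - 3 e)]. The factors 3 come from
    the coordinatewise bound on dot products. *)
Lemma virial_derivative_ge (R : realType) (J : 'M[R]_3) (k K e : R)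
    (rho u v w : 'cV[R]_3) :
  0 <= k -> 0 <= K -> 0 <= e ->
  (forall i, (w i 0) ^+ 2 <= K * dotmul w (J *m w)) ->
  0 <= dotmul w (J *m w) ->
  rho = enorm rho *: u -> dotmul u u = 1 -> dotmul v v = 1 ->
  dotmul v (J *m w) = 0 -> (forall i, `|(v + u) i 0| <= e) ->
  enorm rho * dotmul w (J *m w) * (1 - 3 * e * (1 + 3 * entry_sum J * K)) <=
  dotmul (crossmul (J *m w) w + k *: crossmul rho v) (crossmul rho v) +
    dotmul (J *m w) (crossmul rho (crossmul v w)).
Proof.
set q := dotmul w (J *m w); set N := enorm rho; set A := entry_sum J.
move=> k0 K0 e0 wK q0 rhoE u1 v1 vJw vu; rewrite virial_derivative -/q.
have N0 : 0 <= N := sqrtr_ge0 _.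
pose s := Num.sqrt (K * q).
have s2 : s ^+ 2 = K * q by rewrite sqr_sqrtr// mulr_ge0.
have ws i : `|w i 0| <= s by rewrite -sqrtr_sqr ler_sqrt ?mulr_ge0.
have coord1 (y : 'cV[R]_3) i : dotmul y y = 1 -> `|y i 0| <= 1.
  by move=> y1; have := coord_le_enorm y i; rewrite /enorm y1 sqrtr1.
(* Zero vertical momentum allows [v] to be added to [u], which produces the small factor [v + u]. *)
have Lrho : dotmul (J *m w) rho = N * dotmul (J *m w) (v + u).
  by rewrite dotmulDr (dotmulC _ v) vJw add0r {1}rhoE dotmulZr.
have h1 : `|dotmul (J *m w) (v + u)| <= 3 * (A * s * e).
  by apply: norm_dotmul_le => // i; exact: norm_mulmx_le.
have h2 : `|dotmul w v| <= 3 * (s * 1).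
  by apply: norm_dotmul_le => // i; exact: coord1.
have h3 : `|dotmul u (v + u)| <= 3 * (1 * e).
  by apply: norm_dotmul_le => // i; exact: coord1.
have rhov : - dotmul rho v = N * (1 - dotmul u (v + u)).
  by rewrite {1}rhoE dotmulZl dotmulDr u1; ring.
have h12 : `|dotmul (J *m w) (v + u) * dotmul w v| <= 9 * A * K * q * e.
  rewrite normrM; apply: le_trans (ler_pM _ _ h1 h2) _ => //.
  rewrite [leLHS](_ : _ = 9 * A * s ^+ 2 * e); last by ring.
  by rewrite s2 !mulrA.
have kv : 0 <= k * dotmul (crossmul rho v) (crossmul rho v).
  by rewrite mulr_ge0// dotmul_ge0.
rewrite -(mulrN q) rhov Lrho.
move: h12 h3; rewrite !ler_norml => /andP[h12 _] /andP[_ h3].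
have := ler_wpM2l N0 h12; have := ler_wpM2l (mulr_ge0 N0 q0) h3.
lra.
Qed.

Unset Implicit Arguments.

Theorem proposition14 (R : realType) (J : 'M[R]_3) (m g : R) (rho : 'cV[R]_3)
    (hJ : sym_posdef J) (hm : 0 < m) (hg : 0 < g) (hrho : rho != 0) :
  unstable_equilibrium (pendulum_trajectory J m g rho) (inverted_equilibrium rho).
Proof.
split; first exact: inverted_equilibriumP.
move=> stable.
have N0 := enorm_gt0 hrho; set N := enorm rho in N0.
pose u := N^-1 *: rho.
have rhoE : rho = N *: u by rewrite scalerA divff ?scale1r// gt_eqF.
have u1 : dotmul u u = 1.
  by rewrite dotmulZl dotmulZr -sqr_enorm -/N; field; rewrite gt_eqF.
have k0 : 0 <= m * g by rewrite mulr_ge0// ltW.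
have [K K0 HK] := posdef_coercive hJ.
pose A := entry_sum J.
have A0 : 0 <= A by apply: sumr_ge0 => i _; apply: sumr_ge0.
(* Chosen so that the last factor of [virial_derivative_ge] is exactly 1/2. *)
pose e := (6 * (1 + 3 * A * K))^-1.
have D0 : 0 < 1 + 3 * A * K by rewrite ltr_wpDr// !mulr_ge0// ltW.
have e0 : 0 < e by rewrite invr_gt0 mulr_gt0.
have eE : 1 - 3 * e * (1 + 3 * A * K) = 2^-1 by rewrite /e; field; rewrite gt_eqF.
have [d d0 Hd] := stable e e0.
have [w w0 wJu] := exists_orthogonal (J *m u).
have nw0 : 0 < `|w| by rewrite normr_gt0.
(* Scales [w] to sup norm [d / 2], inside the ball of radius [d] given by stability. *)
pose tau := d / (2 * `|w|).
have tau0 : 0 < tau by rewrite divr_gt0// mulr_gt0.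
pose omega0 := tau *: w.
pose q0 := dotmul omega0 (J *m omega0).
have q0_gt0 : 0 < q0.
  by apply: hJ.2; rewrite scaler_eq0 negb_or w0 gt_eqF.
have mu0 : dotmul (- u) (J *m omega0) = 0.
  by rewrite dotmulNl -scalemxAr dotmulZr (posdef_dotmulC hJ) wJu mulr0 oppr0.
have Nu1 : dotmul (- u) (- u) = 1 by rewrite dotmulNl dotmulNr opprK.
have [Gamma [omega [mot G0 om0]]] := @motion_existence R J (m * g) rho hJ (- u) omega0 k0 Nu1.
have traj : pendulum_trajectory J m g rho (fun t => (Gamma t, omega t)).
  by apply: motion_trajectory mot _; rewrite G0.
have close (t : R) : 0 <= t -> (forall i, `|(Gamma t + u) i 0| <= e) /\
    (forall i, `|omega t i 0| <= e).
  move=> t0.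
  have : `|(Gamma t, omega t) - inverted_equilibrium rho| < e.
    apply: (Hd _ traj) => //.
    rewrite G0 om0 /inverted_equilibrium -/N -/u prod_normE/= subr0 subrr normr0.
    rewrite gt_max d0/= normrZ gtr0_norm// /tau.
    rewrite [ltLHS](_ : _ = d / 2); last by field; rewrite gt_eqF.
    by lra.
  rewrite /inverted_equilibrium -/N -/u prod_normE/= subr0 opprK gt_max.
  by move=> /andP[/ltW h1 /ltW h2]; split=> i;
    [apply: le_trans h1|apply: le_trans h2]; exact: coord_le_mx_norm.
pose f t := dotmul (J *m omega t) (crossmul rho (Gamma t)).
pose df t := dotmul (crossmul (J *m omega t) (omega t) +
    (m * g) *: crossmul rho (Gamma t)) (crossmul rho (Gamma t)) +
  dotmul (J *m omega t) (crossmul rho (crossmul (Gamma t) (omega t))).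
have [cG cw D] := mot.
have cf : continuous f.
  apply: continuous_dotmul; first exact: coord_continuous_mulmx.
  exact: coord_continuous_crossmul.
have Df (t : R) : 0 < t -> is_derive t 1 f (df t).
  move=> t0; have [DG [dw Dw Jdw]] := D t t0; rewrite !scale1r in DG Jdw.
  rewrite /df -Jdw.
  exact: (is_derive_dotmul (coord_derive_mulmx J Dw) (coord_derive_crossmul rho DG)).
have G1 (t : R) : 0 <= t -> dotmul (Gamma t) (Gamma t) = 1.
  by move=> t0; rewrite (motion_dotmul_Gamma mot t0) G0.
pose delta := N * q0 / 2.
have delta0 : 0 < delta by rewrite divr_gt0// mulr_gt0.
have df_ge (t : R) : 0 < t -> delta <= df t.
  move=> /ltW t0; have [cl _] := close t t0.
  have q_ge : q0 <= dotmul (omega t) (J *m omega t).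
    have := motion_energy hJ mot t0; rewrite om0 G0 -/q0.
    have := norm_dotmul_le_enorm rho (G1 _ t0); rewrite ler_norml => /andP[h1 _].
    have -> : dotmul rho (- u) = - N by rewrite {1}rhoE dotmulNr dotmulZl u1 mulr1.
    by move: (ler_wpM2l k0 h1); rewrite -/N; lra.
  apply: le_trans (virial_derivative_ge k0 (ltW K0) (ltW e0) (HK (omega t)) _ rhoE
    u1 (G1 _ t0) _ cl).
  - by rewrite -/A eE /delta ler_pM2r// ler_wpM2l// ltW.
  - exact: posdef_ge0.
  - by rewrite (motion_vertical_momentum mot t0) G0 om0.
(* Coordinates are at most [A * e] for [J omega], [N] for [rho] and 1 for [Gamma]; the cross product
   costs a factor 2 and the dot product a factor 3. *)
pose B := 3 * (A * e * (2 * (N * 1))).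
have fB (t : R) : 0 <= t -> `|f t| <= B.
  move=> t0; have [_ cl] := close t t0.
  apply: norm_dotmul_le => i; first exact: norm_mulmx_le.
  apply: norm_crossmul_le => j; first exact: coord_le_enorm.
  by have := coord_le_enorm (Gamma t) j; rewrite /enorm G1// sqrtr1.
have B0 : 0 <= B by exact: le_trans (fB 0 (lexx 0)).
(* By time [T] the function [f] has grown by at least [delta * T = 2 * B + 1], more than the bound
   [B] on its absolute value permits. *)
pose T := (2 * B + 1) / delta.
have T0 : 0 < T by rewrite divr_gt0// ltr_wpDl// mulr_ge0.
have [||s] := @MVT R f df 0 T T0.
- by move=> s; rewrite in_itv/= => /andP[s0 _]; exact: Df.
- exact: continuous_subspaceT.
rewrite in_itv/= subr0 => /andP[s0 _] fT.
have : delta * T <= f T - f 0 by rewrite fT ler_wpM2r ?df_ge// ltW.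
rewrite mulrC divfK ?gt_eqF//.
have := fB T (ltW T0); have := fB 0 (lexx 0); rewrite !ler_norml.
by move=> /andP[? ?] /andP[? ?]; lra.
Qed.
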